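(* Let $A,B,H\in\mathbb{R}^{n\times n}$, let $Q\in\mathbb{R}^{n\times n}$ be nonsingular, and let $\theta>0$. Let $A=M-N$ and $Q=Q_1-Q_2$ with $M$ and $Q_1$ nonsingular. Put $$a=\Vert M^{-1}N\Vert,\quad c=\Vert M^{-1}BQ\Vert,\quad d=\Vert Q_1^{-1}Q_2\Vert,\quad \alpha=\Vert Q_1^{-1}\Vert,\quad \beta=\Vert Q_1^{-1}H\Vert .$$ If $$\big|a|1-\theta|+\theta ad-c\beta\big|<1\quad\text{and}\quad c(\theta\alpha+2\beta)<(1-a)(1-|1-\theta|-\theta d),$$ then for any $b\in\mathbb{R}^n$ the equation $Ax-B|x|-b=0$ has a unique solution $x^*\in\mathbb{R}^n$, and the sequence $\{(x^{(k)},y^{(k)})\}_{k=0}^\infty$ generated by the GRMS iteration converges to $(x^*,y^* )$ with $y^*=Q^{-1}|x^*|$.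
   Context: For $x\in\mathbb{R}^n$, $|x|$ is the vector with components $|x_i|$. $\Vert\cdot\Vert$ is the Euclidean norm for vectors and the induced 2-norm for matrices. The GRMS iteration for $Ax-B|x|-b=0$ starts from given arbitrary initial vectors $x^{(0)},y^{(0)}\in\mathbb{R}^n$ and computes, for $k=0,1,2,\dots$, $$x^{(k+1)}=M^{-1}Nx^{(k)}+M^{-1}BQy^{(k)}+M^{-1}b,$$ $$y^{(k+1)}=(1-\theta)y^{(k)}+\theta Q_1^{-1}Q_2y^{(k)}+\theta Q_1^{-1}|x^{(k+1)}|+Q_1^{-1}Hx^{(k+1)}-Q_1^{-1}Hx^{(k)}.$$ *)

(* Defs.v *)
From HB Require Import structures.
From mathcomp Require Import all_boot all_order all_algebra.
From mathcomp Require Import all_classical all_reals all_analysis.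

Set Implicit Arguments.
Unset Strict Implicit.
Unset Printing Implicit Defensive.

Import Order.TTheory GRing.Theory Num.Theory.
Import numFieldNormedType.Exports.

Local Open Scope classical_set_scope.
Local Open Scope ring_scope.

(* The norm [`|_|] that MathComp-Analysis puts on matrices is the entrywise
   maximum, hence the separate Euclidean norm and componentwise absolute
   value. *)
Definition norm2 (R : realType) (n : nat) (v : 'cV[R]_n) : R :=
  Num.sqrt (\sum_(i < n) v i 0 ^+ 2).

(* For [n = 0] there is no unit vector and the value is [sup set0 = 0]. *)
Definition mxnorm2 (R : realType) (m n : nat) (A : 'M[R]_(m, n)) : R :=
  sup [set norm2 (A *m v) | v in [set v : 'cV[R]_n | norm2 v = 1]].

Definition absv (R : realType) (n : nat) (v : 'cV[R]_n) : 'cV[R]_n :=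
  \col_i `|v i 0|.

Definition grms_step (R : realType) (n : nat) (M N B Q Q1 Q2 H : 'M[R]_n)
    (theta : R) (b : 'cV[R]_n) (xy : 'cV[R]_n * 'cV[R]_n) :
    'cV[R]_n * 'cV[R]_n :=
  let: (x, y) := xy in
  let x' := invmx M *m N *m x + invmx M *m B *m Q *m y + invmx M *m b in
  let y' := (1 - theta) *: y + theta *: (invmx Q1 *m Q2 *m y)
            + theta *: (invmx Q1 *m absv x')
            + invmx Q1 *m H *m x' - invmx Q1 *m H *m x in
  (x', y').

Definition grms (R : realType) (n : nat) (M N B Q Q1 Q2 H : 'M[R]_n)
    (theta : R) (b x0 y0 : 'cV[R]_n) (k : nat) : 'cV[R]_n * 'cV[R]_n :=
  iter k (grms_step M N B Q Q1 Q2 H theta b) (x0, y0).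

(* Main.v *)
Require Import Defs.
From HB Require Import structures.
From mathcomp Require Import all_boot all_order all_algebra.
From mathcomp Require Import all_classical all_reals all_analysis.
From mathcomp Require Import ring lra.
Import Order.TTheory GRing.Theory Num.Theory.
Import numFieldNormedType.Exports.
Local Open Scope classical_set_scope.
Local Open Scope ring_scope.

Set Implicit Arguments.
Unset Strict Implicit.
Unset Printing Implicit Defensive.

(** Why the theorem holds.  Write [G] for one step of the iteration, acting on
pairs [(x, y)].  A pair is a fixed point of [G] exactly when [x] solves the
absolute value equation and [y = Q^-1 |x|] ([grms_step_fixpoint]): the terms in
[H] cancel, [theta] can be divided out, and what is left of the two lines is
[M x = N x + B Q y + b] and [Q y = |x|].  So existence, uniqueness and
convergence all follow once [G] is shown to be a contraction for some norm
equivalent to the ambient one.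

Since [| |u| - |v| |] is at most [|u - v|] entrywise, the errors of two runs of
the step are bounded entrywise by a nonnegative 2x2 matrix applied to the pair
of Euclidean norms of the previous errors ([grms_step_error]):
[[
  T = (a  c)      s = (theta alpha + beta) a + beta,
      (s  t),     t = |1 - theta| + theta d + (theta alpha + beta) c.
]]
The two hypotheses are the Schur-Cohn conditions [|det T| < 1] and
[tr T < 1 + det T], which say that the spectral radius of [T] is below 1.  For a
nonnegative matrix this amounts to [a < 1], [t < 1] and
[c s < (1 - a) (1 - t)] ([schur_cohn_nonneg]), and these give a positive row
vector [(1, w)] with [(1, w) T <= q (1, w)] for some [q < 1]
([contraction_weight]).  Hence [G] contracts [norm2 x + w * norm2 y] by the
factor [q].

That weighted norm differs from the maximum norm that defines convergence of
pairs, so the fixed point theorem is proved for a contraction measured by a gauge comparable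
with the norm ([gauge_contraction_fixpoint]). *)

(** * The Euclidean norm of vectors and its induced matrix norm *)

Lemma norm2_ge0 (R : realType) (n : nat) (v : 'cV[R]_n) : 0 <= norm2 v.
Proof. exact: sqrtr_ge0. Qed.

Lemma sqr_norm2 (R : realType) (n : nat) (v : 'cV[R]_n) :
  norm2 v ^+ 2 = \sum_(i < n) v i 0 ^+ 2.
Proof. by rewrite sqr_sqrtr// sumr_ge0// => i _; exact: sqr_ge0. Qed.

Lemma norm2_le (R : realType) (m n : nat) (u : 'cV[R]_m) (v : 'cV[R]_n) :
  \sum_i u i 0 ^+ 2 <= \sum_i v i 0 ^+ 2 -> norm2 u <= norm2 v.
Proof. by move=> uv; rewrite ler_sqrt// sumr_ge0// => i _; exact: sqr_ge0. Qed.

Lemma norm2Z (R : realType) (n : nat) (t : R) (v : 'cV[R]_n) :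
  norm2 (t *: v) = `|t| * norm2 v.
Proof.
rewrite /norm2 -sqrtr_sqr -sqrtrM ?sqr_ge0// mulr_sumr.
by congr Num.sqrt; apply: eq_bigr => i _; rewrite mxE exprMn.
Qed.

Lemma norm2_entry (R : realType) (n : nat) (v : 'cV[R]_n) (i : 'I_n) :
  `|v i 0| <= norm2 v.
Proof.
rewrite -sqrtr_sqr ler_sqrt; last by rewrite sumr_ge0// => j _; exact: sqr_ge0.
rewrite (bigD1 i)//= lerDl sumr_ge0// => j _; exact: sqr_ge0.
Qed.

Lemma norm2_eq0 (R : realType) (n : nat) (v : 'cV[R]_n) :
  norm2 v = 0 -> v = 0.
Proof.
move=> v0; apply/matrixP => i j; rewrite ord1 !mxE.
by apply/normr0_eq0/le_anti; rewrite normr_ge0 -v0 norm2_entry.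
Qed.

Lemma norm2_0 (R : realType) (n : nat) : norm2 (0 : 'cV[R]_n) = 0.
Proof. by rewrite -(scale0r 0) norm2Z normr0 mul0r. Qed.

Lemma norm2N (R : realType) (n : nat) (v : 'cV[R]_n) : norm2 (- v) = norm2 v.
Proof. by rewrite -scaleN1r norm2Z normrN normr1 mul1r. Qed.

Lemma cauchy_schwarz (R : realType) (n : nat) (u v : 'cV[R]_n) :
  \sum_(i < n) u i 0 * v i 0 <= norm2 u * norm2 v.
Proof.
have [/norm2_eq0 ->|u0] := eqVneq (norm2 u) 0.
  rewrite norm2_0 mul0r big1// => i _; by rewrite mxE mul0r.
have [/norm2_eq0 ->|v0] := eqVneq (norm2 v) 0.
  rewrite norm2_0 mulr0 big1// => i _; by rewrite mxE mulr0.
have uv_gt0 : 0 < norm2 u * norm2 v by rewrite mulr_gt0// lt0r ?u0 ?v0 norm2_ge0.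
(* Expand [sum_i (|v| u_i - |u| v_i)^2 >= 0], which is
   [2 |u| |v| (|u| |v| - <u, v>) >= 0]. *)
have : 0 <= \sum_(i < n) (norm2 v * u i 0 - norm2 u * v i 0) ^+ 2.
  by rewrite sumr_ge0// => i _; exact: sqr_ge0.
have -> : \sum_(i < n) (norm2 v * u i 0 - norm2 u * v i 0) ^+ 2 =
    norm2 v ^+ 2 * (\sum_i u i 0 ^+ 2) + norm2 u ^+ 2 * (\sum_i v i 0 ^+ 2)
    - 2 * (norm2 u * norm2 v) * \sum_i u i 0 * v i 0.
  rewrite !mulr_sumr -big_split/= -sumrB; apply: eq_bigr => i _; ring.
rewrite -!sqr_norm2 => h.
rewrite -(ler_pM2l uv_gt0); lra.
Qed.

Lemma ler_norm2D (R : realType) (n : nat) (u v : 'cV[R]_n) :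
  norm2 (u + v) <= norm2 u + norm2 v.
Proof.
rewrite -ler_sqr ?nnegrE ?addr_ge0 ?norm2_ge0// sqrrD !sqr_norm2.
have -> : \sum_(i < n) (u + v) i 0 ^+ 2 = \sum_(i < n) u i 0 ^+ 2 +
    (\sum_(i < n) u i 0 * v i 0) *+ 2 + \sum_(i < n) v i 0 ^+ 2.
  rewrite -sumrMnl -!big_split/=; apply: eq_bigr => i _.
  by rewrite mxE sqrrD.
by rewrite lerD2r lerD2l lerMn2r cauchy_schwarz.
Qed.

Lemma norm2_leD (R : realType) (n : nat) (u v : 'cV[R]_n) (x y : R) :
  norm2 u <= x -> norm2 v <= y -> norm2 (u + v) <= x + y.
Proof. by move=> ux vy; rewrite (le_trans (ler_norm2D _ _))// lerD. Qed.

Lemma norm2_absvB (R : realType) (n : nat) (u v : 'cV[R]_n) :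
  norm2 (absv u - absv v) <= norm2 (u - v).
Proof.
apply: norm2_le; apply: ler_sum => i _; rewrite !mxE.
rewrite -[leLHS]real_normK ?num_real// -[leRHS]real_normK ?num_real//.
by rewrite lerXn2r ?nnegrE// ler_dist_dist.
Qed.

(** The ambient norm [`|v|] is the largest entry in absolute value; this lemma
and the next one compare it with [norm2], so that convergence can be read off
from Euclidean estimates. *)
Lemma normr_le_norm2 (R : realType) (n : nat) (v : 'cV[R]_n) :
  `|v| <= norm2 v.
Proof.
change (mx_norm v <= norm2 v); rewrite mx_normrE.
apply: bigmax_le => [|[i j] _]; first exact: norm2_ge0.
by rewrite /= ord1 norm2_entry.
Qed.

Lemma norm2_le_normr (R : realType) (n : nat) (v : 'cV[R]_n) :
  norm2 v <= Num.sqrt n%:R * `|v|.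
Proof.
rewrite -ler_sqr ?nnegrE ?mulr_ge0 ?norm2_ge0 ?sqrtr_ge0//.
rewrite sqr_norm2 exprMn sqr_sqrtr ?ler0n//.
have -> : n%:R * `|v| ^+ 2 = \sum_(i < n) `|v| ^+ 2.
  by rewrite sumr_const card_ord mulr_natl.
apply: ler_sum => i _; rewrite -real_normK ?num_real// lerXn2r ?nnegrE//.
change (`|v i 0| <= mx_norm v); rewrite mx_normrE.
exact: (le_bigmax _ (fun ij => `|v ij.1 ij.2|) (i, 0)).
Qed.

(** Cauchy-Schwarz against each row bounds [norm2 (A *m v)] by the Frobenius
norm of [A].  This is what makes the supremum defining [mxnorm2] a genuine upper
bound: [sup] of an unbounded set would be a junk value. *)
Lemma norm2_mulmx_bound (R : realType) (m n : nat) (A : 'M[R]_(m, n)) :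
  exists C : R, forall v, norm2 (A *m v) <= C * norm2 v.
Proof.
pose r i := norm2 (row i A)^T.
exists (Num.sqrt (\sum_i r i ^+ 2)) => v.
have S0 : 0 <= \sum_i r i ^+ 2 by rewrite sumr_ge0// => i _; exact: sqr_ge0.
rewrite -ler_sqr ?nnegrE ?mulr_ge0 ?norm2_ge0 ?sqrtr_ge0//.
rewrite exprMn (sqr_sqrtr S0) sqr_norm2 mulr_suml; apply: ler_sum => i _.
have inner (w : 'cV[R]_n) : (A *m w) i 0 <= r i * norm2 w.
  rewrite mxE (le_trans _ (cauchy_schwarz (row i A)^T w))//.
  by apply: ler_sum => j _; rewrite !mxE.
have abs_inner : `|(A *m v) i 0| <= r i * norm2 v.
  rewrite ler_norml (inner v) andbT lerNl -(norm2N v).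
  by apply: le_trans (inner (- v)); rewrite mulmxN [leRHS]mxE.
rewrite -exprMn -[leLHS]real_normK ?num_real//.
apply: lerXn2r abs_inner; rewrite nnegrE//.
by rewrite mulr_ge0// norm2_ge0.
Qed.

Lemma mxnorm2_ub (R : realType) (m n : nat) (A : 'M[R]_(m, n)) v :
  norm2 v = 1 -> norm2 (A *m v) <= mxnorm2 A.
Proof.
move=> v1; apply: ub_le_sup; last by exists v.
have [C AC] := norm2_mulmx_bound A.
by exists C => _ [w /= w1 <-]; rewrite (le_trans (AC w))// w1 mulr1.
Qed.

(** In dimension 0 there is no unit vector and the value is [sup set0 = 0], so
that case needs its own argument. *)
Lemma mxnorm2_ge0 (R : realType) (m n : nat) (A : 'M[R]_(m, n)) :
  0 <= mxnorm2 A.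
Proof.
have [[v v1]|noV] := pselect (exists v : 'cV[R]_n, norm2 v = 1).
  by rewrite (le_trans (norm2_ge0 _) (mxnorm2_ub A v1)).
rewrite /mxnorm2 (_ : [set v | norm2 v = 1] = set0) ?image_set0 ?sup0//.
by apply/seteqP; split=> // v v1; apply: noV; exists v.
Qed.

Lemma norm2_mulmx (R : realType) (m n : nat) (A : 'M[R]_(m, n)) v :
  norm2 (A *m v) <= mxnorm2 A * norm2 v.
Proof.
have [/[dup] v0 /norm2_eq0 ->|v0] := eqVneq (norm2 v) 0.
  by rewrite mulmx0 !norm2_0 mulr0.
have v_gt0 : 0 < norm2 v by rewrite lt0r v0 norm2_ge0.
have nV : `|(norm2 v)^-1| = (norm2 v)^-1 by rewrite ger0_norm// invr_ge0 ltW.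
have := @mxnorm2_ub _ _ _ A ((norm2 v)^-1 *: v).
rewrite norm2Z nV mulVf// => /(_ erefl).
by rewrite -scalemxAr norm2Z nV ler_pdivrMl// mulrC.
Qed.

(** * Fixed points of contractions *)

(** Matrices over a real field carry a complete uniform structure and a norm
separately; restating completeness at the normed type joins the two, making
[completeNormedModType] available for ['cV[R]_n]. *)
HB.instance Definition _ (R : realType) (m n : nat) :=
  Uniform_isComplete.Build (matrix R m n) cauchy_cvg.

(** The increments form an absolutely convergent series, whose partial sums
telescope to [u - u 0]. *)
Lemma geometric_increments_cvg (R : realType) (V : completeNormedModType R)
    (u : V^nat) (C q : R) :
  0 <= q < 1 -> (forall k, `|u k.+1 - u k| <= C * q ^+ k) -> cvgn u.
Proof.
move=> /andP[q0 q1] uq.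
have C0 : 0 <= C by have := le_trans (normr_ge0 _) (uq 0%N); rewrite mulr1.
have cvt : cvgn (series (telescope u)).
  apply: normed_cvg.
  apply: (@series_le_cvg _ _ (geometric C q)) => //=.
  - by move=> k; rewrite mulr_ge0 ?exprn_ge0.
  - by apply: is_cvg_geometric_series; rewrite ger0_norm.
have -> : u = (fun k => u 0%N + series (telescope u) k).
  by apply/funext => k; exact: eq_sum_telescope.
by apply: is_cvgD cvt; exact: is_cvg_cst.
Qed.

(** Banach's theorem with the contraction measured by [E] in place of the norm.
The bound of the norm by [E] makes orbits have geometric increments; the bound
of [E] by the norm makes [G] continuous, so the limits are fixed points.  The
limit of an orbit is taken componentwise, which uses completeness of [V] and [W]
only.  Convergence from every starting point to the same limit costs nothing
more, since every orbit converges to some fixed point and there is only one. *)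
Lemma gauge_contraction_fixpoint (R : realType)
    (V W : completeNormedModType R) (E : V * W -> R) (G : V * W -> V * W)
    (q K L : R) :
    0 <= q < 1 -> 0 <= K -> 0 <= L ->
    (forall z, `|z| <= K * E z) -> (forall z, E z <= L * `|z|) ->
    (forall z z', E (G z - G z') <= q * E (z - z')) ->
  exists zs, [/\ G zs = zs, forall z, G z = z -> z = zs &
    forall z0, iter k G z0 @[k --> \oo] --> zs].
Proof.
move=> q01 K0 L0 KE EL Gq; have /andP[q0 q1] := q01.
have fix_unique z z' : G z = z -> G z' = z' -> z = z'.
  move=> Gz Gz'; have := Gq z z'; rewrite Gz Gz' => Eq.
  have E0 : E (z - z') <= 0 by nra.
  apply/eqP; rewrite -subr_eq0 -normr_le0 (le_trans (KE _))//.
  by rewrite mulr_ge0_le0.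
have orbit_cvg z0 : exists2 zs, G zs = zs & iter k G z0 @[k --> \oo] --> zs.
  pose z k := iter k G z0.
  have incrE k : E (z k.+1 - z k) <= q ^+ k * E (G z0 - z0).
    elim: k => [|k ih]; first by rewrite expr0 mul1r.
    by rewrite (le_trans (Gq _ _))// exprS -mulrA ler_wpM2l.
  have incr k : `|z k.+1 - z k| <= K * E (G z0 - z0) * q ^+ k.
    by rewrite (le_trans (KE _))// -mulrA ler_wpM2l// mulrC.
  have cv1 : cvgn (fun k => (z k).1).
    apply: (geometric_increments_cvg q01) => k; apply: le_trans (incr k).
    by rewrite prod_normE le_max lexx.
  have cv2 : cvgn (fun k => (z k).2).
    apply: (geometric_increments_cvg q01) => k; apply: le_trans (incr k).
    by rewrite prod_normE le_max lexx orbT.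
  pose zs := (limn (fun k => (z k).1), limn (fun k => (z k).2)).
  have zE : (fun k => ((z k).1, (z k).2)) = z.
    by apply/funext => k; case: (z k).
  have cvz : z k @[k --> \oo] --> zs by rewrite -zE; exact: cvg_pair.
  exists zs => //.
  have Gcont : z k.+1 @[k --> \oo] --> G zs.
    apply/cvgrPdist_le => e e0.
    have c0 : 0 < e / (K * (q * L) + 1).
      by rewrite divr_gt0// ltr_wpDl// !mulr_ge0.
    have /cvgrPdist_le/(_ _ c0) := cvz.
    apply: filterS => k zk; rewrite (le_trans (KE _))//.
    have zk' : `|zs - z k| * (K * (q * L) + 1) <= e.
      by rewrite -ler_pdivlMr// ltr_wpDl// !mulr_ge0.
    apply: le_trans zk'.
    have h : K * E (G zs - G (z k)) <= K * (q * (L * `|zs - z k|)).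
      by rewrite ler_wpM2l// (le_trans (Gq _ _))// ler_wpM2l.
    apply: le_trans h _; have := normr_ge0 (zs - z k); lra.
  have cvS : z k.+1 @[k --> \oo] --> zs.
    by move=> A /cvz[m _ mA]; exists m => // k mk; apply: mA; exact: leqW.
  exact: (cvg_unique _ Gcont cvS).
have [zs Gzs _] := orbit_cvg 0.
exists zs; split=> // [z Gz|z0]; first exact: fix_unique.
have [zs' Gzs'] := orbit_cvg z0.
by rewrite (fix_unique _ _ Gzs' Gzs).
Qed.

(** * Nonnegative 2x2 comparison matrices *)

(** A weight must satisfy [c < w * (1 - t)] and [w * s < 1 - a].  The last
hypothesis says exactly that these leave room for [w]; the choice below exceeds
the lower limit [c / (1 - t)] by [e / (1 - t)], with [e] small enough for the
upper one. *)
Lemma contraction_weight (R : realFieldType) (a c s t : R) :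
    0 <= a -> 0 <= c -> 0 <= s -> 0 <= t -> a < 1 -> t < 1 ->
    c * s < (1 - a) * (1 - t) ->
  exists w q, [/\ 0 < w, 0 <= q < 1, a + w * s <= q & c + w * t <= q * w].
Proof.
move=> a0 c0 s0 t0 a1 t1 D0.
pose D := (1 - a) * (1 - t) - c * s.
have D_gt0 : 0 < D by rewrite subr_gt0.
pose e := D / (s + 1).
have e_gt0 : 0 < e by rewrite divr_gt0// ltr_wpDl.
have es : e * s < D.
  by rewrite /e mulrAC ltr_pdivrMr ?ltr_wpDl// ltr_pM2l// ltrDl.
pose w := (c + e) / (1 - t).
have t1' : 0 < 1 - t by rewrite subr_gt0.
have wE : w * (1 - t) = c + e by rewrite /w divfK// gt_eqF.
have w_gt0 : 0 < w by rewrite divr_gt0// ltr_wpDl.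
have ws : a + w * s < 1.
  rewrite -ltrBrDl -(ltr_pM2r t1') mulrAC wE; rewrite /D in es; lra.
have wt : (c + w * t) / w < 1 by rewrite ltr_pdivrMr//; lra.
exists w, (Num.max (a + w * s) ((c + w * t) / w)); split => //.
- rewrite gt_max ws wt andbT le_max addr_ge0// mulr_ge0//; exact: ltW.
- by rewrite le_max lexx.
- by rewrite -ler_pdivrMr// le_max lexx orbT.
Qed.

(** The matrix with rows [(a, c)] and [((k + b) * a + b, p + (k + b) * c)] has
determinant [a * p - c * b], and the last two hypotheses say that its determinant
is below 1 and its trace below 1 plus its determinant.  They leave two possibilities, [a] and [p] both below 1 or both
above 1; the second is excluded because [a + p] is at most the trace, which is
less than [1 + det < 2]. *)
Lemma schur_cohn_nonneg (R : realFieldType) (a b c k p : R) :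
    0 <= a -> 0 <= b -> 0 <= c -> 0 <= k -> 0 <= p ->
    a * p - c * b < 1 -> c * (k + 2 * b) < (1 - a) * (1 - p) ->
  [/\ a < 1, p + (k + b) * c < 1 &
    c * ((k + b) * a + b) < (1 - a) * (1 - (p + (k + b) * c))].
Proof.
move=> a0 b0 c0 k0 p0 hdet htr.
have ck : 0 <= c * k by rewrite mulr_ge0.
have cb : 0 <= c * b by rewrite mulr_ge0.
have sum2 : a + p < 2 by nra.
have prod0 : 0 < (1 - a) * (1 - p) by lra.
have a1 : a < 1 by rewrite ltNge; apply/negP => a1; nra.
have p1 : p < 1 by nra.
have ap : (1 - a) * (1 - p) <= 1 - p by nra.
by split; rewrite //; lra.
Qed.

(** * The GRMS step *)

(** In the second line the two [H]-terms cancel at a fixed point and the factor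
[theta] divides out, leaving [Q1 y = Q2 y + |x|], that is [Q y = |x|]; the first
line then is the equation for [x] multiplied by [M^-1]. *)
Lemma grms_step_fixpoint (R : realType) (n : nat)
    (M N B Q Q1 Q2 H : 'M[R]_n) (theta : R) (b x y : 'cV[R]_n) :
    theta != 0 ->
    M \in unitmx -> Q1 \in unitmx -> Q1 - Q2 = Q -> Q \in unitmx ->
  grms_step M N B Q Q1 Q2 H theta b (x, y) = (x, y) <->
  (M - N) *m x - B *m absv x - b = 0 /\ y = invmx Q *m absv x.
Proof.
move=> theta0 uM uQ1 Q12 uQ; rewrite /grms_step; split.
- case=> ex; rewrite ex => ey.
  have Qy : Q *m y = absv x.
    have : theta *: (invmx Q1 *m (Q2 *m y + absv x) - y) = 0.
      rewrite -[RHS](subrr y) -{3}ey mulmxDr !mulmxA scalerBr scalerDr.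
      rewrite scalerBl scale1r; apply/matrixP => i j; rewrite !mxE; ring.
    move/eqP; rewrite scaler_eq0 (negPf theta0)/= subr_eq0 => /eqP yE.
    by rewrite -Q12 mulmxBl -{1}yE mulKVmx// addrC addKr.
  split; last by rewrite -Qy mulKmx.
  have Mx : M *m x = N *m x + B *m absv x + b.
    by rewrite -{1}ex !mulmxDr -Qy -!mulmxA !mulKVmx.
  by rewrite mulmxBl Mx; apply/matrixP => i j; rewrite !mxE; ring.
- case=> eqx yE.
  have Qy : Q *m y = absv x by rewrite yE mulKVmx.
  have ex : invmx M *m N *m x + invmx M *m B *m Q *m y + invmx M *m b = x.
    rewrite -!mulmxA Qy -!mulmxDr; apply: (canLR (mulKmx uM)).
    by move: eqx; rewrite mulmxBl => /eqP; rewrite subr_eq0 => /eqP <-;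
       apply/matrixP => i j; rewrite !mxE; ring.
  rewrite ex; congr (_, _).
  have yE1 : y = invmx Q1 *m Q2 *m y + invmx Q1 *m absv x.
    rewrite -mulmxA -mulmxDr -Qy -Q12 mulmxBl addrC subrK mulKmx //.
  rewrite addrK -addrA -scalerDr -yE1 -scalerDl subrK scale1r //.
Qed.

(** The step is affine in [(x, y)] up to the entrywise absolute value, which is
1-Lipschitz for [norm2].  The second component involves the new [x], so the
first bound is substituted in the second one; this yields the products of
[theta * alpha + beta] with [a] and [c]. *)
Lemma grms_step_error (R : realType) (n : nat) (M N B Q Q1 Q2 H : 'M[R]_n)
    (theta : R) (b : 'cV[R]_n) (z z' : 'cV[R]_n * 'cV[R]_n) :
    0 <= theta ->
  let a := mxnorm2 (invmx M *m N) in
  let c := mxnorm2 (invmx M *m B *m Q) in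
  let d := mxnorm2 (invmx Q1 *m Q2) in
  let alpha := mxnorm2 (invmx Q1) in
  let beta := mxnorm2 (invmx Q1 *m H) in
  let s := (theta * alpha + beta) * a + beta in
  let t := `|1 - theta| + theta * d + (theta * alpha + beta) * c in
  let G := grms_step M N B Q Q1 Q2 H theta b in
  norm2 (G z - G z').1 <= a * norm2 (z - z').1 + c * norm2 (z - z').2 /\
  norm2 (G z - G z').2 <= s * norm2 (z - z').1 + t * norm2 (z - z').2.
Proof.
move=> theta_ge0 a c d alpha beta s t.
case: z => x y; case: z' => x' y' /=.
set u := _ + invmx M *m b; set u' := _ + invmx M *m b.
have hu : norm2 (u - u') <= a * norm2 (x - x') + c * norm2 (y - y').
  have -> : u - u' =
      invmx M *m N *m (x - x') + invmx M *m B *m Q *m (y - y').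
    by rewrite !mulmxBr; apply/matrixP => i j; rewrite !mxE; ring.
  by apply: norm2_leD; exact: norm2_mulmx.
split=> //.
set v := (X in norm2 X).
have {v} -> : v = (1 - theta) *: (y - y')
    + theta *: (invmx Q1 *m Q2 *m (y - y'))
    + theta *: (invmx Q1 *m (absv u - absv u'))
    + invmx Q1 *m H *m (u - u') - invmx Q1 *m H *m (x - x').
  rewrite /v !mulmxBr; apply/matrixP => i j; rewrite !mxE; ring.
have h1 : norm2 ((1 - theta) *: (y - y')) <= `|1 - theta| * norm2 (y - y').
  by rewrite norm2Z.
have h2 : norm2 (theta *: (invmx Q1 *m Q2 *m (y - y'))) <=
    theta * (d * norm2 (y - y')).
  by rewrite norm2Z ger0_norm// ler_wpM2l//; exact: norm2_mulmx.
have h3 : norm2 (theta *: (invmx Q1 *m (absv u - absv u'))) <=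
    theta * (alpha * norm2 (u - u')).
  rewrite norm2Z ger0_norm// ler_wpM2l//.
  rewrite (le_trans (norm2_mulmx _ _))// ler_wpM2l ?mxnorm2_ge0//.
  exact: norm2_absvB.
have h4 : norm2 (invmx Q1 *m H *m (u - u')) <= beta * norm2 (u - u').
  exact: norm2_mulmx.
have h5 : norm2 (invmx Q1 *m H *m (x - x')) <= beta * norm2 (x - x').
  exact: norm2_mulmx.
have hk : (theta * alpha + beta) * norm2 (u - u') <=
    (theta * alpha + beta) * (a * norm2 (x - x') + c * norm2 (y - y')).
  by rewrite ler_wpM2l// addr_ge0 ?mulr_ge0 ?mxnorm2_ge0.
have h5N := h5; rewrite -norm2N in h5N.
apply: (le_trans (norm2_leD (norm2_leD (norm2_leD (norm2_leD h1 h2) h3) h4) h5N)).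
rewrite /s /t; lra.
Qed.

Unset Implicit Arguments.

Theorem theorem1 (R : realType) (n : nat)
    (A B H Q M N Q1 Q2 : 'M[R]_n) (theta : R)
    (hQ : Q \in unitmx) (htheta : 0 < theta)
    (hA : A = M - N) (hQ12 : Q = Q1 - Q2)
    (hM : M \in unitmx) (hQ1 : Q1 \in unitmx) :
  let a := mxnorm2 (invmx M *m N) in
  let c := mxnorm2 (invmx M *m B *m Q) in
  let d := mxnorm2 (invmx Q1 *m Q2) in
  let alpha := mxnorm2 (invmx Q1) in
  let beta := mxnorm2 (invmx Q1 *m H) in
  `|a * `|1 - theta| + theta * a * d - c * beta| < 1 ->
  c * (theta * alpha + 2 * beta) < (1 - a) * (1 - `|1 - theta| - theta * d) ->
  forall b : 'cV[R]_n,
  exists xs : 'cV[R]_n,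
    (A *m xs - B *m absv xs - b = 0 /\
     forall x : 'cV[R]_n, A *m x - B *m absv x - b = 0 -> x = xs) /\
    forall x0 y0 : 'cV[R]_n,
      grms M N B Q Q1 Q2 H theta b x0 y0 k @[k --> \oo]
        --> (xs, invmx Q *m absv xs).
Proof.
move=> a c d alpha beta hdet htr b.
pose s := (theta * alpha + beta) * a + beta.
pose t := `|1 - theta| + theta * d + (theta * alpha + beta) * c.
have [a1 t1 D0] : [/\ a < 1, t < 1 & c * s < (1 - a) * (1 - t)].
  apply: schur_cohn_nonneg; rewrite ?mxnorm2_ge0//.
  - by rewrite mulr_ge0 ?mxnorm2_ge0// ltW.
  - by rewrite addr_ge0// mulr_ge0 ?mxnorm2_ge0// ltW.
  - by move: hdet; rewrite ltr_norml => /andP[_]; lra.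
  - by move: htr; lra.
have a0 : 0 <= a := mxnorm2_ge0 _.
have c0 : 0 <= c := mxnorm2_ge0 _.
have k0 : 0 <= theta * alpha + beta.
  by rewrite addr_ge0 ?mulr_ge0 ?mxnorm2_ge0// ltW.
have s0 : 0 <= s by rewrite addr_ge0 ?mxnorm2_ge0// mulr_ge0.
have t0 : 0 <= t.
  by rewrite !addr_ge0 ?mulr_ge0 ?mxnorm2_ge0// ltW.
have [w [q [w0 q01 wx wy]]] := contraction_weight a0 c0 s0 t0 a1 t1 D0.
pose G := grms_step M N B Q Q1 Q2 H theta b.
pose E (z : 'cV[R]_n * 'cV[R]_n) := norm2 z.1 + w * norm2 z.2.
have E_contr z z' : E (G z - G z') <= q * E (z - z').
  have [ex ey] := grms_step_error M N B Q Q1 Q2 H b z z' (ltW htheta).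
  have := ler_wpM2r (norm2_ge0 (z - z').1) wx.
  have := ler_wpM2r (norm2_ge0 (z - z').2) wy.
  have := ler_wpM2l (ltW w0) ey.
  move: ex; rewrite /E -/a -/c -/G -/beta -/alpha -/d -/s -/t; lra.
have normE z : `|z| <= (1 + w^-1) * E z.
  have n1 := norm2_ge0 z.1; have n2 := norm2_ge0 z.2.
  have wn2 : w^-1 * (w * norm2 z.2) = norm2 z.2 by rewrite mulKf// gt_eqF.
  have wn1 : 0 <= w^-1 * norm2 z.1 by rewrite mulr_ge0// invr_ge0 ltW.
  have wn3 : 0 <= w * norm2 z.2 by rewrite mulr_ge0// ltW.
  rewrite prod_normE ge_max /E; apply/andP.
  by split; apply: (le_trans (normr_le_norm2 _)); lra.
have Enorm z : E z <= (1 + w) * Num.sqrt n%:R * `|z|.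
  have r0 : 0 <= Num.sqrt n%:R :> R := sqrtr_ge0 _.
  have z1 : Num.sqrt n%:R * `|z.1| <= Num.sqrt n%:R * `|z|.
    by rewrite ler_wpM2l// prod_normE le_max lexx.
  have z2 : Num.sqrt n%:R * `|z.2| <= Num.sqrt n%:R * `|z|.
    by rewrite ler_wpM2l// prod_normE le_max lexx orbT.
  have := le_trans (norm2_le_normr z.1) z1.
  have := ler_wpM2l (ltW w0) (le_trans (norm2_le_normr z.2) z2).
  rewrite /E; lra.
have [] := gauge_contraction_fixpoint q01 _ _ normE Enorm E_contr.
- by rewrite addr_ge0// invr_ge0 ltW.
- by rewrite mulr_ge0 ?sqrtr_ge0// addr_ge0// ltW.
move=> [xs ys] [Gzs uniq cvg_zs].
have fixE x y := grms_step_fixpoint N B H b x y (lt0r_neq0 htheta) hM hQ1 (esym hQ12) hQ.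
have [xs_sol ysE] := (fixE xs ys).1 Gzs.
exists xs; split; first split.
- by rewrite hA.
- move=> x x_sol; have [] // : (x, invmx Q *m absv x) = (xs, ys).
  by apply: uniq; apply/fixE; rewrite -hA.
- by move=> x0 y0; rewrite -ysE; exact: cvg_zs.
Qed.
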